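(* For all $\alpha \in (0,1)\cap \mathbb{Q}$ and all real $x>1$, we have $$\# T_{\leq x}(\alpha)\geq \left\lfloor \frac{\log(16x)}{4\lceil \sqrt{2}\, d(\alpha)\rceil \log(1+\sqrt{2})}\right\rfloor.$$ In particular, $T(\alpha)$ is infinite for all $\alpha\in(0,1)\cap\mathbb{Q}$.
   Context: $\mathbb{N}$ is the set of positive integers; $\lfloor x\rfloor$ is the integer part (floor) of $x$, and $\lceil x\rceil=-\lfloor -x\rfloor$. For $\alpha\in\mathbb{Q}$, $d(\alpha)$ denotes the positive denominator of $\alpha$ written as an irreducible fraction. For $X\subseteq\mathbb{N}$, $T(X)$ is the set of all tuples $(k,\ell,m)\in\mathbb{N}^3$ with $k\leq \ell\leq m$ such that all of $k,\ \ell,\ m,\ k+\ell,\ \ell+m,\ m+k,\ k+\ell+m$ belong to $X$. For $\alpha>0$, let $S(\alpha)=\{\lfloor \alpha n^2\rfloor : n\in\mathbb{N},\ n\geq \alpha^{-1/2}\}$ and $T(\alpha)=T(S(\alpha))$. For $\alpha>0$ and $x>1$, let $T_{\leq x}(\alpha)=\{(\lfloor \alpha n_1^2\rfloor,\lfloor\alpha n_2^2\rfloor,\lfloor\alpha n_3^2\rfloor)\in T(\alpha) : n_1,n_2,n_3\in[\alpha^{-1/2},x]\cap\mathbb{N}\}$. *)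

(* Defs.v *)
From HB Require Import structures.
From mathcomp Require Import all_boot all_order all_algebra.
From mathcomp Require Import finmap.
From mathcomp Require Import all_classical all_reals all_analysis.

Set Implicit Arguments.
Unset Strict Implicit.
Unset Printing Implicit Defensive.

Import Order.TTheory GRing.Theory Num.Theory.

Local Open Scope classical_set_scope.
Local Open Scope ring_scope.

(* The set of positive integers is the subset of [nat] cut out by [0 < n];
   [sumT X] therefore requires positivity explicitly, and it suffices to
   require it of the smallest component. *)
Definition sumT (X : set nat) : set (nat * nat * nat) :=
  [set t | let: (k, l, m) := t in
    [/\ (0 < k)%N, (k <= l)%N & (l <= m)%N] /\
    [/\ X k, X l & X m] /\
    [/\ X (k + l)%N, X (l + m)%N, X (m + k)%N & X (k + l + m)%N]].

(* [Num.truncn] is the integer part, as a natural number, of a nonnegative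
   real. *)
Definition floor_sq (R : realType) (alpha : R) (n : nat) : nat :=
  Num.truncn (alpha * n%:R ^+ 2).

Definition admissible (R : realType) (alpha : R) : set nat :=
  [set n | (0 < n)%N /\ alpha `^ (- (1 / 2)) <= n%:R].

Definition S_set (R : realType) (alpha : R) : set nat :=
  floor_sq alpha @` admissible alpha.

Definition T_set (R : realType) (alpha : R) : set (nat * nat * nat) :=
  sumT (S_set alpha).

Definition T_le (R : realType) (alpha x : R) : set (nat * nat * nat) :=
  [set t | T_set alpha t /\
    exists n1 n2 n3 : nat,
      [/\ admissible alpha n1, admissible alpha n2 & admissible alpha n3] /\
      [/\ n1%:R <= x, n2%:R <= x & n3%:R <= x] /\
      t = (floor_sq alpha n1, floor_sq alpha n2, floor_sq alpha n3)].

(* [fset_set] returns the empty set on infinite sets; the following shows that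
   [#|` fset_set (T_le alpha x)|] is the true cardinality. *)
Lemma finite_T_le (R : realType) (alpha x : R) : finite_set (T_le alpha x).
Proof.
pose B := `I_(Num.truncn x).+1.
pose f := fun p : nat * nat * nat =>
  (floor_sq alpha p.1.1, floor_sq alpha p.1.2, floor_sq alpha p.2).
have fB : finite_set (f @` (B `*` B `*` B)).
  by apply: finite_image; do 2?apply: finite_setX; exact: finite_II.
apply: sub_finite_set fB => t [_ [n1 [n2 [n3 [_ [[h1 h2 h3] ->]]]]]].
exists (n1, n2, n3) => //=.
have nB n : n%:R <= x -> B n.
  move=> nx; rewrite /B /= ltnS -(natrK (R := R) n).
  exact: le_truncn.
by do !split => /=; exact: nB.
Qed.

(* Main.v *)
(** Write alpha = a/d. If K is a multiple of d and n^2 is K or K + 1, then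
    floor (alpha n^2) = alpha K because alpha < 1. So it suffices to find
    multiples k = l and m of d such that k, m, 2k, k + m and 2k + m are all of
    the form n^2 or n^2 - 1. A solution of v^2 = 8 u^2 + 1 with d | u provides
    them: k = l = 8 u^2 and m = (4 u^2 - 1)^2 - 1.

    These u are the terms of the Lucas sequence U_(n+2) = 6 U_(n+1) - U_n, and
    d divides some U_r with 1 <= r <= d, hence every U_(jr). This bound on the
    rank is multiplicative in d because U_(mn)(P) = U_m(P) U_n(V_m(P)); for a
    prime p it follows from U_(i+j) U_(j-i) = U_j^2 - U_i^2 and a pigeonhole on
    the squares modulo p. Since 32 U_n^2 <= (1 + sqrt 2)^(4n) and
    d + 1 <= ceil (sqrt 2 d), enough of these triples lie below x. *)

Require Import Defs.
From HB Require Import structures.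
From mathcomp Require Import all_boot all_order all_algebra.
From mathcomp Require Import finmap.
From mathcomp Require Import all_classical all_reals all_analysis.
From mathcomp Require Import zify ring lra.

Import Order.TTheory GRing.Theory Num.Theory.

Local Open Scope classical_set_scope.
Local Open Scope ring_scope.

(** * Lucas sequences with parameters (P, 1) *)

Fixpoint lucasU (P : int) (n : nat) : int :=
  if n is n1.+1 then
    if n1 is n2.+1 then P * lucasU P n1 - lucasU P n2 else 1
  else 0.

(** The companion sequence: V_0 = 2, V_1 = P, with the same recurrence. *)
Definition lucasV (P : int) (n : nat) : int :=
  2 * lucasU P n.+1 - P * lucasU P n.

Lemma lucasUSS P n : lucasU P n.+2 = P * lucasU P n.+1 - lucasU P n.
Proof. by []. Qed.

Lemma nat_ind2 (Q : nat -> Prop) :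
  Q 0%N -> Q 1%N -> (forall n, Q n -> Q n.+1 -> Q n.+2) -> forall n, Q n.
Proof.
move=> Q0 Q1 QSS n; suff [] : Q n /\ Q n.+1 by [].
by elim: n => [//|n [Qn QSn]]; split=> //; apply: QSS.
Qed.

Lemma lucasU_cassini P n :
  lucasU P n.+1 ^+ 2 - P * lucasU P n.+1 * lucasU P n + lucasU P n ^+ 2 = 1.
Proof. by elim: n => [|n IH]; [rewrite /=; ring | rewrite -IH lucasUSS; ring]. Qed.

Lemma lucasUD P m n :
  lucasU P (m + n) = lucasU P m * lucasU P n.+1 + lucasU P m.+1 * lucasU P n
                     - P * lucasU P m * lucasU P n.
Proof.
elim/nat_ind2: n => [||n IH IH1].
- by rewrite addn0 /=; ring.
- by rewrite addn1 !lucasUSS /=; ring.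
- by rewrite !addnS lucasUSS -addnS IH IH1 !lucasUSS; ring.
Qed.

(** Both sides satisfy the same recurrence in [n]; Cassini's identity settles n = 1. Along steps of
    [m], U thus obeys a Lucas recurrence with parameter V_m. *)
Lemma lucasU_add_double P m n :
  lucasU P (n + m + m) = lucasV P m * lucasU P (n + m) - lucasU P n.
Proof.
have C := lucasU_cassini P m.
elim/nat_ind2: n => [||n IH IH1].
- by rewrite add0n lucasUD /lucasV /=; ring.
- have E : lucasU P (1 + m + m) = lucasU P m.+1 ^+ 2 - lucasU P m ^+ 2.
    by rewrite add1n lucasUD lucasUSS; ring.
  by rewrite E add1n /lucasV /= -[X in _ = _ - X]C; ring.
- by rewrite !addSn lucasUSS -!addSn IH IH1 !addSn !lucasUSS; ring.
Qed.

Lemma lucasUM P m n :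
  lucasU P (n * m) = lucasU P m * lucasU (lucasV P m) n.
Proof.
elim/nat_ind2: n => [||n IH IH1].
- by rewrite mul0n /=; ring.
- by rewrite mul1n /=; ring.
- have -> : (n.+2 * m = n * m + m + m)%N by rewrite !mulSn; lia.
  rewrite lucasU_add_double (_ : n * m + m = n.+1 * m)%N; last by rewrite mulSn addnC.
  by rewrite IH IH1 lucasUSS; ring.
Qed.

Lemma lucasU_sqrB P m n :
  lucasU P (n + m + m) * lucasU P n = lucasU P (n + m) ^+ 2 - lucasU P m ^+ 2.
Proof.
rewrite lucasU_add_double lucasUD /lucasV.
have Cm := lucasU_cassini P m; have Cn := lucasU_cassini P n.
set a := lucasU P m in Cm *; set a1 := lucasU P m.+1 in Cm *.
set b := lucasU P n in Cn *; set b1 := lucasU P n.+1 in Cn *.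
(* The two Cassini relations, with cofactors a^2 and b^2, turn the claim into a polynomial
   identity. *)
transitivity ((a * b1 + a1 * b - P * a * b) ^+ 2
  - a ^+ 2 * (b1 ^+ 2 - P * b1 * b + b ^+ 2)
  + b ^+ 2 * (a1 ^+ 2 - P * a1 * a + a ^+ 2 - 1)); first by ring.
by rewrite Cm Cn; ring.
Qed.

(** * Rank of appearance modulo d *)

Lemma lucasU_prime_rank P p : (2 %| P)%Z -> prime p ->
  exists2 c : nat, (0 < c <= p)%N & (p %| lucasU P c)%Z.
Proof.
move=> P2 pP; have [->|p_odd] := even_prime pP.
  (* U_2 = P is even. *)
  by exists 2%N => //; rewrite lucasUSS /= mulr1 subr0.
have p_gt0 : (0 < p)%N by exact: prime_gt0.
pose r c := `|(lucasU P c %% p)%Z|%N.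
have rE c : (r c)%:Z = (lucasU P c %% p)%Z.
  by rewrite /r gez0_abs // modz_ge0 // eqz_nat -lt0n.
have r_lt c : (r c < p)%N by rewrite -ltz_nat rE ltz_pmod.
have r_dvd c : (p %| lucasU P c - (r c)%:Z)%Z.
  by rewrite rE -eqz_mod_dvd modz_mod.
have p2 : (p./2.*2.+1 = p)%N by rewrite -[RHS]odd_double_half p_odd.
(* This minimum records the residue up to sign, hence determines the square modulo [p]. *)
have g_lt c : (minn (r c) (p - r c) < p./2.+1)%N.
  by move: (r_lt c) p2; rewrite -muln2; lia.
(* There are only (p+1)/2 squares modulo p, so two of the (p+3)/2 numbers
   U_0^2, ..., U_{(p+1)/2}^2 coincide modulo p. *)
have [i [j [ij jh pij]]] : exists i j, [/\ (i < j)%N, (j < p./2.+2)%N &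
    (p %| lucasU P j ^+ 2 - lucasU P i ^+ 2)%Z].
  pose g (c : 'I_(p./2.+2)) : 'I_(p./2.+1) := Ordinal (g_lt c).
  have /injectivePn [a [b ab gab]] : ~~ injectiveb g.
    apply/negP => /injectiveP/leq_card; rewrite !card_ord; lia.
  wlog ab' : a b ab gab / (a < b)%N => [H|].
    have := ab; rewrite -val_eqE neq_ltn => /orP[|] h; first exact: (H a b).
    by apply: (H b a) => //; rewrite eq_sym.
  exists a, b; split=> //.
  move/(congr1 val): gab => /= gab.
  have rab : r b = r a \/ (r b + r a)%N = p.
    by move: (r_lt a) (r_lt b) gab; lia.
  rewrite subr_sqr; case: rab => rab.
  - apply: dvdz_mulr.
    rewrite (_ : _ - _ = (lucasU P b - (r b)%:Z) - (lucasU P a - (r a)%:Z)).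
      by apply: rpredB; exact: r_dvd.
    by rewrite rab; ring.
  - apply: dvdz_mull.
    rewrite (_ : _ + _ = (lucasU P b - (r b)%:Z) + (lucasU P a - (r a)%:Z)
                     + (r b + r a)%N%:Z).
      by apply: rpredD; [apply: rpredD; exact: r_dvd | rewrite rab dvdzz].
    by rewrite PoszD; ring.
(* [p] divides U_(j+i) U_(j-i), hence a factor; both indices lie in [1, p] because i < j <=
   (p+1)/2. *)
have E : (j - i + i + i = j + i)%N by lia.
have := lucasU_sqrB P i (j - i); rewrite E subnK ?(ltnW ij) // => EE.
move: pij; rewrite -EE dvdzE abszM Euclid_dvdM // => /orP[] h.
- by exists (j + i)%N => //; move: p2; rewrite -muln2; lia.
- by exists (j - i)%N => //; move: p2; rewrite -muln2; lia.
Qed.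

(** The induction on [d] ranges over all even [P]: splitting off a prime factor replaces [P] by
    [lucasV P c1], which is again even. *)
Lemma lucasU_rank P d : (2 %| P)%Z -> (0 < d)%N ->
  exists2 c : nat, (0 < c <= d)%N & (d %| lucasU P c)%Z.
Proof.
elim/ltn_ind: d P => d IH P P2 d_gt0.
have [d_le1|d_gt1] := leqP d 1.
  have -> : d = 1%N by lia.
  by exists 1%N.
have pP := pdiv_prime d_gt1; set p := pdiv d in pP.
have [c1 /andP[c1_gt0 c1p] pU] := @lucasU_prime_rank P p P2 pP.
have dE : (d = (d %/ p) * p)%N by rewrite divnK // pdiv_dvd.
have e_gt0 : (0 < d %/ p)%N by rewrite divn_gt0 ?pdiv_gt0 // dvdn_leq // pdiv_dvd.
have V2 : (2 %| lucasV P c1)%Z.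
  by rewrite /lucasV rpredB // ?dvdz_mulr // dvdz_mulr.
have [|c2 /andP[c2_gt0 c2e] eU] := IH (d %/ p)%N _ _ V2 e_gt0.
  by rewrite ltn_Pdiv // prime_gt1.
exists (c2 * c1)%N; first by rewrite muln_gt0 c1_gt0 c2_gt0 /= dE leq_mul.
by rewrite lucasUM dE PoszM mulrC dvdz_mul.
Qed.

Lemma lucasU_increasing P n : 2 <= P ->
  (0 <= lucasU P n) && (lucasU P n < lucasU P n.+1).
Proof.
move=> P2; elim: n => [//|n /andP[U0 U1]].
rewrite (le_trans U0 (ltW U1)) lucasUSS.
by move: U0 U1; move: (lucasU P n) (lucasU P n.+1) => y z; nia.
Qed.

Lemma lucasU_dvd P m n : (lucasU P m %| lucasU P (n * m))%Z.
Proof. by rewrite lucasUM dvdz_mulr. Qed.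

(** * Squares near multiples of d, and triples from the Pell equation *)

Section floor_sq_near.
Variables (R : realType) (a d n c e : nat).
Hypotheses (ad : (0 < a < d)%N) (nE : (n ^ 2 = d * c + e)%N) (e1 : (e <= 1)%N).

Let d_gt0 : 0 < d%:R :> R. Proof. by rewrite ltr0n; lia. Qed.

Lemma floor_sq_near : floor_sq (a%:R / d%:R : R) n = (a * c)%N.
Proof.
have E : a%:R / d%:R * n%:R ^+ 2 = (a * c)%:R + (a * e)%:R / d%:R :> R.
  rewrite -natrX nE natrD !natrM; field.
  by rewrite gt_eqF.
rewrite /floor_sq E; apply: truncn_def.
rewrite lerDl divr_ge0 ?ler0n //= -natr1 ltrD2l ltr_pdivrMr // mul1r ltr_nat.
by move: e1 ad; nia.
Qed.

(** n^2 >= d c >= d >= d/a = 1/alpha. *)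
Lemma admissible_near : (0 < c)%N -> admissible (a%:R / d%:R : R) n.
Proof.
move=> c_gt0.
have n_gt0 : (0 < n)%N by rewrite lt0n; apply/eqP => n0; move: nE ad; rewrite n0; nia.
have al : 0 < a%:R / d%:R :> R by rewrite divr_gt0 // ltr0n; lia.
split=> //; rewrite div1r powRN powR12_sqrt ?(ltW al) //.
rewrite -[_^-1]div1r ler_pdivrMr ?sqrtr_gt0 // -[X in X <= _]sqrtr1.
rewrite -[n%:R]ger0_norm ?ler0n // -sqrtr_sqr -sqrtrM ?sqr_ge0 //.
rewrite ler_wsqrtr // mulrA ler_pdivlMr // mul1r -natrX -natrM ler_nat nE.
by move: ad; nia.
Qed.

End floor_sq_near.

(* With u = d w, the integers 8 u^2 and 16 u^4 - 8 u^2 are multiples of d, and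
   their sums, like themselves, are of the form n^2 or n^2 - 1:
     8 u^2 = v^2 - 1,             16 u^4 - 8 u^2 = (4 u^2 - 1)^2 - 1,
     8 u^2 + 8 u^2 = (4 u)^2,     8 u^2 + (16 u^4 - 8 u^2) = (4 u^2)^2,
     8 u^2 + 8 u^2 + (16 u^4 - 8 u^2) = (4 u^2 + 1)^2 - 1. *)
Definition pell_triple (a d w : nat) : nat * nat * nat :=
  (a * (8 * d * w ^ 2), a * (8 * d * w ^ 2),
   a * (16 * d ^ 3 * w ^ 4 - 8 * d * w ^ 2))%N.

Lemma T_le_pell_triple (R : realType) (x : R) (a d w v : nat) :
  (0 < a < d)%N -> (0 < w)%N -> (v ^ 2 = 8 * (d * w) ^ 2 + 1)%N ->
  (4 * (d * w) ^ 2)%:R <= x + 1 ->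
  T_le (a%:R / d%:R) x (pell_triple a d w).
Proof.
move=> ad w_gt0 vE ux; rewrite /pell_triple.
set c1 := (8 * d * w ^ 2)%N; set c3 := (_ - _)%N.
have d_gt0 : (0 < d)%N by lia.
set u := (d * w)%N in vE ux; have u_gt0 : (0 < u)%N by rewrite muln_gt0 d_gt0.
have dc1 : (d * c1 = 8 * u ^ 2)%N by rewrite /c1 /u; ring.
have c1_gt0 : (0 < c1)%N by rewrite -(ltn_pmul2l d_gt0) dc1 muln0 muln_gt0 expn_gt0 u_gt0.
(* The truncated subtraction in [c3] is exact. *)
have c3E : (c3 + c1 = 16 * d ^ 3 * w ^ 4)%N.
  have : (d * w ^ 2 <= d ^ 3 * w ^ 4)%N.
    rewrite (_ : d ^ 3 * w ^ 4 = d * w ^ 2 * (d * w) ^ 2)%N; last by ring.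
    by rewrite leq_pmulr // expn_gt0 u_gt0.
  by rewrite /c3 /c1; lia.
have dc3 : (d * c3 + 8 * u ^ 2 = 16 * u ^ 4)%N.
  by rewrite -dc1 -mulnDr c3E /u; ring.
clearbody c1 c3.
have u2 : (1 <= u ^ 2)%N by rewrite expn_gt0 u_gt0.
have u4 : (u ^ 4 = u ^ 2 * u ^ 2)%N by ring.
have u24 : (u ^ 2 <= u ^ 4)%N by rewrite u4 leq_pmulr.
have E3 : ((4 * u ^ 2 - 1) ^ 2 + 8 * u ^ 2 = 16 * u ^ 4 + 1)%N.
  rewrite u4; move: u2; case: (u ^ 2)%N => // y _.
  by rewrite (_ : 4 * y.+1 - 1 = 4 * y + 3)%N; [ring | lia].
(* So 4 u^2 - 1 is the largest of the three roots, the only one to compare with [x]. *)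
have vn : (v <= 4 * u ^ 2 - 1)%N by rewrite -leq_sqr; lia.
have c13 : (c1 <= c3)%N by rewrite -(leq_pmul2l d_gt0); lia.
have n1E : (v ^ 2 = d * c1 + 1)%N by rewrite vE dc1.
have n3E : ((4 * u ^ 2 - 1) ^ 2 = d * c3 + 1)%N by lia.
have n11E : ((4 * u) ^ 2 = d * (c1 + c1) + 0)%N.
  by rewrite mulnDr dc1; ring.
have n13E : ((4 * u ^ 2) ^ 2 = d * (c1 + c3) + 0)%N.
  by rewrite mulnDr dc1 addn0 addnC dc3; ring.
have n113E : ((4 * u ^ 2 + 1) ^ 2 = d * (c1 + c1 + c3) + 1)%N.
  transitivity (16 * u ^ 4 + 8 * u ^ 2 + 1)%N; first by ring.
  by rewrite !mulnDr dc1 -dc3; ring.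
have S n c e : (n ^ 2 = d * c + e)%N -> (e <= 1)%N -> (0 < c)%N ->
    S_set (a%:R / d%:R : R) (a * c)%N.
  by move=> *; exists n; [apply: admissible_near|apply: floor_sq_near]; eauto.
split.
  have a_gt0 : (0 < a)%N by case/andP: ad.
  split; first by rewrite muln_gt0 a_gt0 c1_gt0 leqnn leq_mul.
  have c3_gt0 := leq_trans c1_gt0 c13.
  rewrite -!mulnDr [(c3 + c1)%N]addnC.
  split; split.
  - exact: S n1E _ _.
  - exact: S n1E _ _.
  - exact: S n3E _ _.
  - by apply: S n11E _ _; rewrite // addn_gt0 c1_gt0.
  - by apply: S n13E _ _; rewrite // addn_gt0 c1_gt0.
  - by apply: S n13E _ _; rewrite // addn_gt0 c1_gt0.
  - by apply: S n113E _ _; rewrite // !addn_gt0 c1_gt0.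
exists v, v, (4 * u ^ 2 - 1)%N; split; [|split].
- have c3_gt0 := leq_trans c1_gt0 c13.
  by split; apply: admissible_near; eauto.
- have q : (4 * u ^ 2 - 1)%:R <= x.
    rewrite natrB; last by rewrite muln_gt0 u2.
    by rewrite lerBlDr.
  have vx : v%:R <= x by apply: le_trans q; rewrite ler_nat.
  by [].
- by congr (_, _, _); symmetry; apply: floor_sq_near; eauto.
Qed.

(** * Pell solutions from U_n(6), their growth, and an infinite family *)

(** Cassini's identity for P = 6 with the square completed. *)
Lemma lucasU_pell n : (lucasU 6 n.+1 - 3 * lucasU 6 n) ^+ 2 = 8 * lucasU 6 n ^+ 2 + 1.
Proof. by rewrite -[X in _ = _ + X](lucasU_cassini 6 n); ring. Qed.

(** For u = U_n and v = U_(n+1) - 3 U_n, v + 2 sqrt 2 u = (1 + sqrt 2)^(2n), as (1 + sqrt 2)^2 = 3 +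
    2 sqrt 2. Since 2 sqrt 2 u <= v, this is at least 4 sqrt 2 u; square. *)
Lemma lucasU_bound (R : realType) n :
  32 * (lucasU 6 n)%:~R ^+ 2 <= (1 + Num.sqrt (2 : R)) ^+ (4 * n).
Proof.
set s := Num.sqrt (2 : R).
have s2 : s * s = 2 by rewrite -expr2 sqr_sqrtr.
have s0 : 0 <= s by exact: sqrtr_ge0.
pose x := lucasU 6 n.+1 - 3 * lucasU 6 n.
have E : x%:~R + 2 * s * (lucasU 6 n)%:~R = (1 + s) ^+ (2 * n).
  rewrite /x; elim: n {x} => [|n IH]; first by rewrite muln0 expr0 /=; ring.
  rewrite mulnS exprD -IH lucasUSS !rmorphB /= !rmorphM /=.
  rewrite expr2 (_ : (1 + s) * (1 + s) = 3 + 2 * s); last by ring: s2.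
  by ring: s2.
have /andP[U0 _] := @lucasU_increasing 6 n isT.
have x0 : 0 <= x.
  rewrite /x; case: (n) => [//|m]; have /andP[] := @lucasU_increasing 6 m isT.
  rewrite lucasUSS; move: (lucasU 6 m) (lucasU 6 m.+1) => y z y0 yz.
  by lia.
have y0 : 0 <= (lucasU 6 n)%:~R :> R by rewrite ler0z.
have yx : 2 * s * (lucasU 6 n)%:~R <= x%:~R.
  rewrite -ler_sqr ?nnegrE ?ler0z // ?mulr_ge0 //.
  rewrite -rmorphXn lucasU_pell rmorphD rmorphM rmorphXn /=.
  by rewrite !exprMn [s ^+ 2]expr2 s2; lra.
rewrite (_ : 4 * n = 2 * n * 2)%N; last by ring.
rewrite exprM -E.
have -> : 32 * (lucasU 6 n)%:~R ^+ 2 = (2 * s * (lucasU 6 n)%:~R * 2) ^+ 2.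
  by rewrite !exprMn [s ^+ 2]expr2 s2; ring.
rewrite ler_sqr ?nnegrE ?addr_ge0 ?mulr_ge0 ?ler0z //.
by lra.
Qed.

Lemma pell_triple_inj a d : (0 < a < d)%N -> injective (pell_triple a d).
Proof.
move=> /andP[a_gt0 ad] w w' /(congr1 (fun t => t.1.1))/eqP.
have d_gt0 := ltn_trans a_gt0 ad.
by rewrite !eqn_pmul2l ?muln_gt0 // eqn_sqr => /eqP.
Qed.

Lemma T_le_family (R : realType) (a d : nat) : (0 < a < d)%N ->
  exists2 f : nat -> nat * nat * nat, injective f &
    forall j (x : R), (1 + Num.sqrt (2 : R)) ^+ (4 * (j.+1 * d)) <= 8 * (x + 1) ->
      T_le (a%:R / d%:R) x (f j).
Proof.
(* The triples come from U_((j+1)r); the shift avoids U_0 = 0. *)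
move=> ad; have d_gt0 : (0 < d)%N by lia.
have [r /andP[r_gt0 rd] dU] := @lucasU_rank 6 d isT d_gt0.
pose u j := `|lucasU 6 (j.+1 * r)|%N.
have U_mono := fun n => @lucasU_increasing 6 n isT.
have U_lt : {homo lucasU 6 : m n / (m < n)%N >-> m < n}.
  apply: (homo_ltn lt_trans) => n; exact: proj2 (andP (U_mono n)).
have uE j : (u j)%:Z = lucasU 6 (j.+1 * r).
  by rewrite /u gez0_abs //; exact: proj1 (andP (U_mono _)).
have du j : (u j = d * (u j %/ d))%N.
  have := dvdz_trans dU (lucasU_dvd 6 r j.+1).
  by rewrite -uE dvdzE /= mulnC => /divnK.
clearbody u.
have u_inj : injective u.
  have u_lt : {homo u : m n / (m < n)%N}.
    by move=> m n mn; rewrite -ltz_nat !uE U_lt // ltn_pmul2r.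
  by move=> m n mn; case: (ltngtP m n) => // /u_lt; rewrite mn ltnn.
exists (fun j => pell_triple a d (u j %/ d)).
  by move=> m n /(pell_triple_inj _ _ ad) E; apply: u_inj; rewrite du E -du.
move=> j x jx.
have u_gt0 : (0 < u j)%N.
  by have := U_lt 0%N (j.+1 * r)%N; rewrite -uE; apply; rewrite muln_gt0.
pose v := `|(lucasU 6 (j.+1 * r).+1 - 3 * lucasU 6 (j.+1 * r))%R|%N.
apply: (T_le_pell_triple R x a d (u j %/ d) v ad).
- by rewrite lt0n; apply: contraTneq u_gt0 => w0; rewrite du w0 muln0.
- by rewrite -du /v -abszX lucasU_pell -uE expr2 -mulnn; lia.
(* As r <= d, 32 u^2 <= 8 (x + 1), which is the required 4 u^2 <= x + 1. *)
- rewrite -du natrM natrX.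
  have := lucasU_bound R (j.+1 * r); rewrite -uE -pmulrn => ub.
  have : (1 + Num.sqrt (2 : R)) ^+ (4 * (j.+1 * r)) <= 8 * (x + 1).
    apply: le_trans jx; rewrite ler_weXn2l ?lerDl ?sqrtr_ge0 //.
    by rewrite !leq_mul.
  by lra.
Qed.

(** * Counting the triples below x *)

Theorem theorem1p2 (R : realType) :
  (forall (alpha : rat) (x : R), 0 < alpha < 1 -> 1 < x ->
     Num.floor (ln (16 * x) /
                (4 * (Num.ceil (Num.sqrt (2 : R) * (denq alpha)%:~R))%:~R
                   * ln (1 + Num.sqrt (2 : R))))
       <= (#|` fset_set (T_le (ratr alpha) x)|)%fset%:Z) /\
  (forall alpha : rat, 0 < alpha < 1 -> infinite_set (T_set (ratr alpha : R))).
Proof.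
have fracE (alpha : rat) : 0 < alpha < 1 -> exists2 a : nat, (0 < a < `|denq alpha|)%N &
    ratr alpha = a%:R / `|denq alpha|%:R :> R.
  move=> /andP[a0 a1]; exists `|numq alpha|%N.
    rewrite -!ltz_nat /= !gtz0_abs ?numq_gt0 // ?a0 ?denq_gt0 //=.
    by move: a1; rewrite -{1}[alpha]divq_num_den ltr_pdivrMr ?ltr0z ?denq_gt0 // mul1r ltr_int.
  by rewrite /ratr !natr_absz !gtr0_norm ?numq_gt0 ?denq_gt0.
set e := 1 + Num.sqrt (2 : R).
have s1 : 1 < Num.sqrt (2 : R) by rewrite -[X in X < _]sqrtr1 ltr_sqrt ?ltr1n.
have e2 : 2 < e by rewrite /e; lra.
split=> [alpha x|alpha] /fracE[a ad ->].
- move=> x1.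
  have [f f_inj fT] := T_le_family R _ _ ad.
  set d := `|denq alpha|%N in ad fT *.
  have dE : denq alpha = d by rewrite /d gtz0_abs ?denq_gt0.
  rewrite dE.
  set M := Num.ceil _.
  have dM : d%:Z < M.
    by rewrite /M ceil_gt_int -pmulrn ltr_pMl // ltr0n; lia.
  case MN : M dM => [m|//]; rewrite ltz_nat => dm.
  have lne : 0 < ln e by rewrite ln_gt0 //; lra.
  case NE : Num.floor => [n|//].
  have : (Posz n)%:~R <= ln (16 * x) / (4 * (Posz m)%:~R * ln e).
    by rewrite -NE floor_le.
  rewrite ler_pdivlMr ?mulr_gt0 ?ltr0z //; last by rewrite ltz_nat; lia.
  rewrite -!pmulrn => le_ln.
  have bound : e ^+ (4 * (n * m)) <= 16 * x.
    rewrite -ler_ln ?posrE ?exprn_gt0 ?mulr_gt0 //; try lra.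
    rewrite lnXn; last by lra.
    by apply: le_trans le_ln; rewrite -[ln e *+ _]mulr_natl !natrM; lra.
  rewrite lez_nat; apply: leq_card_fset_set; first exact: finite_T_le.
  have E : (f @` `I_n #= `I_n)%card by apply: inj_card_eq => ? ? _ _ /f_inj.
  rewrite -(card_le_eql E).
  apply: subset_card_le => _ [j /= jn <-]; apply: fT.
  rewrite -/e.
  (* d + 1 <= m and j < n give 4(j+1)d + 1 <= 4nm; the spare factor e > 2 turns 16 x into 8 x. *)
  have : e ^+ (4 * (j.+1 * d)) * e <= 16 * x.
    apply: le_trans bound; rewrite -exprSr ler_weXn2l //; first by lra.
    have : (j.+1 * d.+1 <= n * m)%N by rewrite leq_mul.
    by rewrite mulnS; lia.
  have : 0 < e ^+ (4 * (j.+1 * d)) by rewrite exprn_gt0 //; lra.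
  by move: (e ^+ _) => y; nra.
- have [f f_inj fT] := T_le_family R _ _ ad.
  apply: sub_infinite_set (_ : infinite_set (range f)).
    move=> _ [j _ <-].
    (* Taking x = y, the power itself, the condition reads y <= 8 (y + 1). *)
    apply: (proj1 (fT j (e ^+ (4 * (j.+1 * `|denq alpha|))) _)).
    rewrite -/e; have : 0 <= e ^+ (4 * (j.+1 * `|denq alpha|)).
      by rewrite exprn_ge0 //; lra.
    by move: (e ^+ _) => y; lra.
  by apply/infiniteP; rewrite (card_le_eqr (inj_card_eq (in2W f_inj))).
Qed.
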